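(* Let $p$ be an odd prime, and let $T$ and $U$ be pruned trees on $\mathbb{N}$ such that $T_1$ and $U_1$ are infinite. Then $[T]$ and $[U]$ are uniformly homeomorphic if and only if $G_T$ is topologically isomorphic to $G_U$.
   Context: A tree on $\mathbb{N}$ is a nonempty $T\subseteq\mathbb{N}^{<\mathbb{N}}$ closed under initial segments; pruned means each node has a proper extension in $T$. $[T]$ is the set of $x\in\mathbb{N}^{\mathbb{N}}$ with all initial segments in $T$, with the ultrametric $d(x,y)=2^{-n}$, $n$ least with $x(n)\ne y(n)$; uniformly homeomorphic means there is a bijection which together with its inverse is uniformly continuous. $T_n=\{s\in T:|s|=n\}$ and $p_n\colon T_{n+1}\to T_n$ is the predecessor map $s\mapsto s\upharpoonright n$ (surjective, since $T$ is pruned). For a countably infinite set $X$, $L(X)=N(X)/\langle\{[a_v,b_v]:v\in X\}\rangle$ where $N(X)$ is the free nilpotent group of class $2$ and exponent $p$ on free generators $\{a_v,b_v:v\in X\}$; a surjection $q\colon X\to Y$ induces the epimorphism $\widehat q\colon L(X)\to L(Y)$, $a_v\mapsto a_{q(v)}$, $b_v\mapsto b_{q(v)}$. $G_T$ is the inverse limit $\varprojlim_{n\in\mathbb{N}}(L(T_{n+1}),\widehat p_{n+1})$, i.e. the closed subgroup $\{x\in\prod_n L(T_{n+1}):\forall n\ \widehat p_{n+1}(x(n+1))=x(n)\}$ of the product of the discrete groups $L(T_{n+1})$; $G_U$ is defined likewise. *)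

(* Defs.v *)
From HB Require Import structures.
From mathcomp Require Import all_boot all_order all_algebra.
From mathcomp Require Import generic_quotient monoid.
From mathcomp Require Import all_classical all_reals topology.

Set Implicit Arguments.
Unset Strict Implicit.
Unset Printing Implicit Defensive.

Import Order.TTheory GRing.Theory Num.Theory.

Local Open Scope classical_set_scope.
Local Open Scope quotient_scope.

Inductive gterm (A : Type) :=
  | GVar of A
  | GOne
  | GMul of gterm A & gterm A
  | GInv of gterm A.
Arguments GOne {A}.

HB.instance Definition _ (A : Type) := gen_eqMixin (gterm A).
HB.instance Definition _ (A : Type) := gen_choiceMixin (gterm A).

Section GtermOps.
Variable A : Type.
Implicit Types s t : gterm A.

Definition gterm_exp s n := iterop n (@GMul A) s GOne.

Definition gterm_comm s t := GMul (GInv s) (GMul (GInv t) (GMul s t)).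

End GtermOps.

(* Terms are related iff they agree under every assignment in every group
   satisfying x ^ p = 1 and [[x, y], z] = 1, so the quotient is the relatively
   free group of that variety; see [nil2_lift_gen] and [nil2_lift_uniq]. *)
Inductive nil2_eq (p : nat) (A : Type) : gterm A -> gterm A -> Prop :=
  | nil2_refl s : nil2_eq p s s
  | nil2_sym s t : nil2_eq p s t -> nil2_eq p t s
  | nil2_trans s t u : nil2_eq p s t -> nil2_eq p t u -> nil2_eq p s u
  | nil2_congM s s' t t' : nil2_eq p s s' -> nil2_eq p t t' ->
      nil2_eq p (GMul s t) (GMul s' t')
  | nil2_congV s s' : nil2_eq p s s' -> nil2_eq p (GInv s) (GInv s')
  | nil2_mulA s t u : nil2_eq p (GMul s (GMul t u)) (GMul (GMul s t) u)
  | nil2_mul1g s : nil2_eq p (GMul GOne s) s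
  | nil2_mulg1 s : nil2_eq p (GMul s GOne) s
  | nil2_mulVg s : nil2_eq p (GMul (GInv s) s) GOne
  | nil2_mulgV s : nil2_eq p (GMul s (GInv s)) GOne
  | nil2_exp s : nil2_eq p (gterm_exp s p) GOne
  | nil2_comm3 s t u : nil2_eq p (gterm_comm (gterm_comm s t) u) GOne.

Section Nil2.
Variables (p : nat) (A : Type).

Definition nil2_rel : rel (gterm A) := fun s t => `[< nil2_eq p s t >].

Lemma nil2_rel_refl : reflexive nil2_rel.
Proof. by move=> s; apply/asboolP/nil2_refl. Qed.

Lemma nil2_rel_sym : symmetric nil2_rel.
Proof. by move=> s t; apply/asboolP/asboolP; exact: nil2_sym. Qed.

Lemma nil2_rel_trans : transitive nil2_rel.
Proof. by move=> t s u /asboolP st /asboolP tu; apply/asboolP/(nil2_trans st). Qed.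

Canonical nil2_equiv := EquivRel nil2_rel nil2_rel_refl nil2_rel_sym nil2_rel_trans.

Definition nil2 : Type := {eq_quot nil2_equiv}.

HB.instance Definition _ := Choice.on nil2.
HB.instance Definition _ := EqQuotient.on nil2.

Lemma nil2_piP s t : \pi_nil2 s = \pi_nil2 t <-> nil2_eq p s t.
Proof.
by split=> [/eqquotP/asboolP//|st]; apply/eqquotP/asboolP.
Qed.

Definition nil2_mul (x y : nil2) : nil2 := \pi_nil2 (GMul (repr x) (repr y)).
Definition nil2_one : nil2 := \pi_nil2 GOne.
Definition nil2_inv (x : nil2) : nil2 := \pi_nil2 (GInv (repr x)).

Lemma nil2_repr s : nil2_eq p (repr (\pi_nil2 s)) s.
Proof. by apply/nil2_piP; rewrite reprK. Qed.

Lemma nil2_piM s t : nil2_mul (\pi s) (\pi t) = \pi_nil2 (GMul s t).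
Proof. by apply/nil2_piP/nil2_congM; exact: nil2_repr. Qed.

Lemma nil2_piV s : nil2_inv (\pi s) = \pi_nil2 (GInv s).
Proof. by apply/nil2_piP/nil2_congV; exact: nil2_repr. Qed.

Let mulA : associative nil2_mul.
Proof.
move=> x y z; rewrite -[x]reprK -[y]reprK -[z]reprK !nil2_piM.
exact/nil2_piP/nil2_mulA.
Qed.

Let mul1g : left_id nil2_one nil2_mul.
Proof.
by move=> x; rewrite -[x]reprK /nil2_one nil2_piM; apply/nil2_piP/nil2_mul1g.
Qed.

Let mulg1 : right_id nil2_one nil2_mul.
Proof.
by move=> x; rewrite -[x]reprK /nil2_one nil2_piM; apply/nil2_piP/nil2_mulg1.
Qed.

Let mulVg : left_inverse nil2_one nil2_inv nil2_mul.
Proof.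
by move=> x; rewrite -[x]reprK nil2_piV nil2_piM; apply/nil2_piP/nil2_mulVg.
Qed.

Let mulgV : right_inverse nil2_one nil2_inv nil2_mul.
Proof.
by move=> x; rewrite -[x]reprK nil2_piV nil2_piM; apply/nil2_piP/nil2_mulgV.
Qed.

HB.instance Definition _ := isGroup.Build nil2 mulA mul1g mulg1 mulVg mulgV.

Definition nil2_gen (a : A) : nil2 := \pi_nil2 (GVar a).

End Nil2.

Definition in_nil2_variety (p : nat) (G : groupType) : Prop :=
  (forall x : G, x ^+ p = 1)%g /\ (forall x y z : G, [~ x, y, z] = 1)%g.

Lemma nil2_variety p A : in_nil2_variety p (nil2 p A).
Proof.
have expE s n : (\pi_(nil2 p A) s ^+ n)%g = \pi_(nil2 p A) (gterm_exp s n).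
  case: n => [|n]; first exact: erefl.
  elim: n => [|n IH]; first exact: erefl.
  by rewrite expgS IH; exact: nil2_piM.
have commE s t :
    [~ \pi_(nil2 p A) s, \pi_(nil2 p A) t]%g = \pi_(nil2 p A) (gterm_comm s t).
  have V u : (\pi_(nil2 p A) u)^-1%g = \pi_(nil2 p A) (GInv u) by exact: nil2_piV.
  have M u v : (\pi_(nil2 p A) u * \pi_(nil2 p A) v)%g = \pi_(nil2 p A) (GMul u v).
    exact: nil2_piM.
  by rewrite /gterm_comm -!(V, M).
split=> [x|x y z]; first by rewrite -[x]reprK expE; exact/nil2_piP/nil2_exp.
rewrite -[x]reprK -[y]reprK -[z]reprK (commE (repr x)) (commE (gterm_comm _ _)).
exact/nil2_piP/nil2_comm3.
Qed.

Section Nil2Lift.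
Variables (p : nat) (A : Type) (G : groupType) (f : A -> G).

Fixpoint gterm_eval (s : gterm A) : G :=
  match s with
  | GVar a => f a
  | GOne => 1
  | GMul s t => gterm_eval s * gterm_eval t
  | GInv s => (gterm_eval s)^-1
  end%g.

Definition nil2_lift (x : nil2 p A) : G := gterm_eval (repr x).

Hypothesis GP : in_nil2_variety p G.

Lemma nil2_eval s t : nil2_eq p s t -> gterm_eval s = gterm_eval t.
Proof.
have [G1 G2] := GP.
elim=> //= [? ? ? _ -> _ ->|? ? ? ? _ -> _ ->|? ? _ ->|? ? ?|?|?|?|?|{}s|? ? ?] //.
- by rewrite mulgA.
- by rewrite mul1g.
- by rewrite mulg1.
- by rewrite mulVg.
- by rewrite mulgV.
- rewrite -[RHS](G1 (gterm_eval s)).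
  case: p => [|n]; first exact: erefl.
  elim: n => [|n IH]; first exact: erefl.
  by rewrite expgS -IH.
- exact: G2.
Qed.

Lemma nil2_lift_gen a : nil2_lift (nil2_gen p a) = f a.
Proof. by rewrite /nil2_lift (nil2_eval (nil2_repr p _)). Qed.

Lemma nil2_liftM : {morph nil2_lift : x y / x * y >-> x * y}%g.
Proof. by move=> x y; rewrite /nil2_lift (nil2_eval (nil2_repr p _)). Qed.

Lemma nil2_lift_uniq (h : {multiplicative nil2 p A -> G}) :
  (forall a, h (nil2_gen p a) = f a) -> h =1 nil2_lift.
Proof.
move=> hf x; have h1 : h 1%g = 1%g by apply: (@mulgI _ (h 1%g)); rewrite -gmulfM !mulg1.
rewrite -[x]reprK /nil2_lift (nil2_eval (nil2_repr p _)).
elim: (repr x) => [a||s IHs t IHt|s IHs] /=; first exact: hf.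
- exact: h1.
- by rewrite -IHs -IHt -gmulfM; congr (h _); exact/esym/nil2_piM.
- apply: (@mulgI _ (h (\pi s))); rewrite -IHs mulgV -gmulfM -[RHS]h1.
  by rewrite -(nil2_piV p s); congr (h _); exact: mulgV.
Qed.

End Nil2Lift.

Definition is_subgroup (G : groupType) (H : set G) : Prop :=
  H 1%g /\ forall x y, H x -> H y -> H (x / y)%g.

Definition subgroup_gen (G : groupType) (S : set G) : set G :=
  smallest (@is_subgroup G) S.

Record normal_subgroup (G : groupType) := NormalSubgroup {
  normal_set : set G;
  normal_is_subgroup : is_subgroup normal_set;
  normal_conj : forall x y, normal_set x -> normal_set (x ^ y)%g }.

Section QuotientGroup.
Variables (G : groupType) (N : normal_subgroup G).

Let N1 : normal_set N 1%g. Proof. by have [] := normal_is_subgroup N. Qed.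
Let NF x y : normal_set N x -> normal_set N y -> normal_set N (x / y)%g.
Proof. by have [_] := normal_is_subgroup N; apply. Qed.
Let NV x : normal_set N x -> normal_set N x^-1%g.
Proof. by move=> Nx; rewrite -div1g; exact: NF. Qed.
Let NM x y : normal_set N x -> normal_set N y -> normal_set N (x * y)%g.
Proof. by move=> Nx /NV Ny; rewrite -[y]invgK; exact: NF. Qed.

Definition coset_rel : rel G := fun x y => `[< normal_set N (x^-1 * y)%g >].

Lemma coset_rel_refl : reflexive coset_rel.
Proof. by move=> x; apply/asboolP; rewrite mulVg. Qed.

Lemma coset_rel_sym : symmetric coset_rel.
Proof.
by move=> x y; apply/asboolP/asboolP=> /NV; rewrite invgM invgK.
Qed.

Lemma coset_rel_trans : transitive coset_rel.
Proof.
move=> y x z /asboolP xy /asboolP yz; apply/asboolP.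
by have := NM xy yz; rewrite mulgA mulgK.
Qed.

Canonical coset_equiv := EquivRel coset_rel coset_rel_refl coset_rel_sym coset_rel_trans.

Definition quot_group : Type := {eq_quot coset_equiv}.

HB.instance Definition _ := Choice.on quot_group.
HB.instance Definition _ := EqQuotient.on quot_group.

Lemma quot_piP x y : \pi_quot_group x = \pi_quot_group y <-> normal_set N (x^-1 * y)%g.
Proof. by split=> [/eqquotP/asboolP//|xy]; apply/eqquotP/asboolP. Qed.

Definition quot_mul (x y : quot_group) : quot_group := \pi_quot_group (repr x * repr y)%g.
Definition quot_one : quot_group := \pi_quot_group 1%g.
Definition quot_inv (x : quot_group) : quot_group := \pi_quot_group (repr x)^-1%g.

Lemma quot_repr x : normal_set N (x^-1 * repr (\pi_quot_group x))%g.
Proof. by apply/quot_piP; rewrite reprK. Qed.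

Lemma quot_piM x y : quot_mul (\pi x) (\pi y) = \pi_quot_group (x * y)%g.
Proof.
apply/esym/quot_piP; rewrite invgM -mulgA.
have := NM (normal_conj y (quot_repr x)) (quot_repr y).
by rewrite /conjg !mulgA mulgK.
Qed.

Lemma quot_piV x : quot_inv (\pi x) = \pi_quot_group x^-1%g.
Proof.
apply/quot_piP; rewrite invgK.
by have := normal_conj x^-1%g (quot_repr x); rewrite /conjg invgK mulgA mulVKg.
Qed.

Let mulA : associative quot_mul.
Proof. by move=> x y z; rewrite -[x]reprK -[y]reprK -[z]reprK !quot_piM mulgA. Qed.

Let mul1q : left_id quot_one quot_mul.
Proof. by move=> x; rewrite -[x]reprK /quot_one quot_piM mul1g. Qed.

Let mulq1 : right_id quot_one quot_mul.
Proof. by move=> x; rewrite -[x]reprK /quot_one quot_piM mulg1. Qed.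

Let mulVq : left_inverse quot_one quot_inv quot_mul.
Proof. by move=> x; rewrite -[x]reprK quot_piV quot_piM mulVg. Qed.

Let mulqV : right_inverse quot_one quot_inv quot_mul.
Proof. by move=> x; rewrite -[x]reprK quot_piV quot_piM mulgV. Qed.

HB.instance Definition _ := isGroup.Build quot_group mulA mul1q mulq1 mulVq mulqV.

End QuotientGroup.

Section LGroup.
Variables (p : nat) (X : Type).

Local Notation NX := (nil2 p (X + X)).

(* [inl v] and [inr v] index the free generators a_v and b_v. *)
Definition L_relators : set NX :=
  [set [~ nil2_gen p (inl v), nil2_gen p (inr v)]%g | v in [set: X]].

Lemma L_relators_normal x y :
  subgroup_gen L_relators x -> subgroup_gen L_relators (x ^ y)%g.
Proof.
have [_ N3] := nil2_variety p (X + X).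
pose C : set NX := [set z | commute z y].
have sub : subgroup_gen L_relators `<=` C.
  apply: smallest_sub; last first.
    move=> _ [v _ <-]; rewrite /C /= /commute.
    by rewrite conjgC -[X in (_ * X)%g](mulVKg [~ nil2_gen p (inl v), nil2_gen p (inr v)])%g
      -commgEl N3 mulg1.
  split=> [|u v Cu Cv]; rewrite /C /=; first exact/commute_sym/commute1.
  apply/commute_sym/commuteM; first exact/commute_sym.
  exact/commuteV/commute_sym.
move=> Lx; have /= cxy := sub _ Lx.
by rewrite conjgE [X in (_ * X)%g]cxy mulKg.
Qed.

Lemma subgroup_gen_is_subgroup (G : groupType) (S : set G) :
  is_subgroup (subgroup_gen S).
Proof.
split=> [|x y Sx Sy] H CH; first exact: CH.1.1.
exact: CH.1.2 (Sx H CH) (Sy H CH).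
Qed.

Definition L_subgroup : normal_subgroup NX :=
  NormalSubgroup (subgroup_gen_is_subgroup L_relators) L_relators_normal.

Definition L : Type := quot_group L_subgroup.

HB.instance Definition _ := Group.on L.
HB.instance Definition _ := EqQuotient.on L.

Definition L_gen (i : X + X) : L := \pi_L (nil2_gen p i).

Lemma L_piM (x y : NX) : \pi_L (x * y)%g = (\pi_L x * \pi_L y)%g.
Proof. exact/esym/quot_piM. Qed.

Lemma L_piV (x : NX) : \pi_L x^-1%g = (\pi_L x)^-1%g.
Proof. exact/esym/quot_piV. Qed.

Lemma L_piR (x y : NX) : \pi_L [~ x, y]%g = [~ \pi_L x, \pi_L y]%g.
Proof. by rewrite /commg /conjg !(L_piM, L_piV). Qed.

Lemma L_variety : in_nil2_variety p L.
Proof.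
have [N1 N2] := nil2_variety p (X + X).
have piX n (u : NX) : \pi_L (u ^+ n)%g = (\pi_L u ^+ n)%g.
  by elim: n => [|n IH]; [exact: erefl | rewrite !expgS L_piM IH].
split=> [x|x y z]; first by rewrite -[x]reprK -piX N1.
by rewrite -[x]reprK -[y]reprK -[z]reprK -(L_piR (repr x)) -(L_piR [~ _, _]%g) N2.
Qed.

Lemma L_gen_comm v : [~ L_gen (inl v), L_gen (inr v)]%g = 1%g.
Proof.
rewrite /L_gen -L_piR -[RHS]/(\pi_L 1%g).
apply/esym/quot_piP; rewrite invg1 mul1g.
by apply: sub_gen_smallest; exists v.
Qed.

End LGroup.

Section LMap.
Variables (p : nat) (X Y : Type) (q : X -> Y).

Definition L_map_gen (i : X + X) : L p Y :=
  match i with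
  | inl v => L_gen p (inl (q v))
  | inr v => L_gen p (inr (q v))
  end.

(* The value does not depend on the representative chosen by [repr]. *)
Definition L_map (x : L p X) : L p Y := nil2_lift L_map_gen (repr x).

Let liftM := @nil2_liftM p _ _ L_map_gen (L_variety p Y).

Let lift1 : nil2_lift (p := p) L_map_gen 1%g = 1%g.
Proof. by apply: (@mulgI _ (nil2_lift (p := p) L_map_gen 1%g)); rewrite -liftM !mulg1. Qed.

Let liftV x : nil2_lift (p := p) L_map_gen x^-1%g = (nil2_lift L_map_gen x)^-1%g.
Proof.
by apply: (@mulgI _ (nil2_lift L_map_gen x)); rewrite -liftM !mulgV lift1.
Qed.

Lemma L_map_pi x : L_map (\pi_(L p X) x) = nil2_lift L_map_gen x.
Proof.
suff sub : subgroup_gen (@L_relators p X) `<=`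
    [set z | nil2_lift L_map_gen z = 1%g].
  have /sub /= := quot_repr (L_subgroup p X) x.
  by rewrite liftM liftV => /mulg1_eq; rewrite invgK.
apply: smallest_sub => [|_ [v _ <-] /=].
  by split=> [//|u v /= u1 v1]; rewrite liftM liftV u1 v1 mulgV.
rewrite /commg /conjg !(liftM, liftV) !(nil2_lift_gen L_map_gen (L_variety p Y)).
exact: L_gen_comm.
Qed.

Lemma L_map_L_gen i : L_map (L_gen p i) = L_map_gen i.
Proof. by rewrite L_map_pi (nil2_lift_gen _ (L_variety p Y)). Qed.

Lemma L_mapM : {morph L_map : x y / x * y >-> x * y}%g.
Proof. by move=> x y; rewrite -[x]reprK -[y]reprK -L_piM !L_map_pi liftM. Qed.

HB.instance Definition _ := isMultiplicative.Build (L p X) (L p Y) L_map L_mapM.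

End LMap.

HB.mixin Record isTopologicalGroup G & Group G & Topological G := {
  mulg_continuous : continuous (fun x : G * G => (x.1 * x.2)%g);
  invg_continuous : continuous (fun x : G => x^-1%g) }.

#[short(type="topologicalGroupType")]
HB.structure Definition TopologicalGroup :=
  { G of Group G & Topological G & isTopologicalGroup G }.

Definition topologically_isomorphic (G H : topologicalGroupType) : Prop :=
  exists (f : {multiplicative G -> H}) (g : H -> G),
    [/\ cancel f g, cancel g f, continuous f & continuous g].

Section InverseLimit.
Variables (G : nat -> groupType) (f : forall n, {multiplicative G n.+1 -> G n}).

Definition inv_lim_set : set (prod_topology (fun n => discrete_topology (G n))) :=
  [set x | forall n, f n (x n.+1) = x n].

Definition inv_lim : Type := set_type inv_lim_set.

HB.instance Definition _ := Topological.on inv_lim.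

Let f1 n : f n 1%g = 1%g.
Proof. by apply: (@mulgI _ (f n 1%g)); rewrite -gmulfM !mulg1. Qed.

Let fV n x : f n x^-1%g = (f n x)^-1%g.
Proof. by apply: (@mulgI _ (f n x)); rewrite -gmulfM !mulgV f1. Qed.

Definition inv_lim_coord (x : inv_lim) n : G n := val x n.

Lemma inv_limP (x : inv_lim) n : f n (inv_lim_coord x n.+1) = inv_lim_coord x n.
Proof. exact: (set_valP x). Qed.

Lemma inv_lim_inj (x y : inv_lim) : (forall n, inv_lim_coord x n = inv_lim_coord y n) -> x = y.
Proof. by move=> xy; apply/val_inj/functional_extensionality_dep. Qed.

Fact inv_lim_one_subproof : inv_lim_set (fun n => 1%g : G n).
Proof. by move=> n; exact: f1. Qed.
Definition inv_lim_one : inv_lim := exist (fun z => z \in inv_lim_set) _ (mem_set inv_lim_one_subproof).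

Fact inv_lim_mul_subproof (x y : inv_lim) :
  inv_lim_set (fun n => inv_lim_coord x n * inv_lim_coord y n)%g.
Proof. by move=> n; rewrite gmulfM !inv_limP. Qed.
Definition inv_lim_mul (x y : inv_lim) : inv_lim :=
  exist (fun z => z \in inv_lim_set) _ (mem_set (inv_lim_mul_subproof x y)).

Fact inv_lim_inv_subproof (x : inv_lim) :
  inv_lim_set (fun n => (inv_lim_coord x n)^-1)%g.
Proof. by move=> n; rewrite fV inv_limP. Qed.
Definition inv_lim_inv (x : inv_lim) : inv_lim :=
  exist (fun z => z \in inv_lim_set) _ (mem_set (inv_lim_inv_subproof x)).

Let mulA : associative inv_lim_mul.
Proof. by move=> x y z; apply: inv_lim_inj => n; exact: mulgA. Qed.
Let mul1l : left_id inv_lim_one inv_lim_mul.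
Proof. by move=> x; apply: inv_lim_inj => n; exact: mul1g. Qed.
Let mull1 : right_id inv_lim_one inv_lim_mul.
Proof. by move=> x; apply: inv_lim_inj => n; exact: mulg1. Qed.
Let mulVl : left_inverse inv_lim_one inv_lim_inv inv_lim_mul.
Proof. by move=> x; apply: inv_lim_inj => n; exact: mulVg. Qed.
Let mullV : right_inverse inv_lim_one inv_lim_inv inv_lim_mul.
Proof. by move=> x; apply: inv_lim_inj => n; exact: mulgV. Qed.

HB.instance Definition _ := isGroup.Build inv_lim mulA mul1l mull1 mulVl mullV.

Lemma inv_lim_coord_near (x : inv_lim) n :
  \forall y \near x, inv_lim_coord y n = inv_lim_coord x n.
Proof.
have nx := discrete_set1 (inv_lim_coord x n : discrete_topology (G n)).
have /= nv := @proj_continuous nat (fun n => discrete_topology (G n)) n (val x) _ nx.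
exact: (@initial_continuous _ _ (@set_val _ inv_lim_set) x _ nv).
Qed.

Lemma inv_lim_cvg (X : topologicalType) (h : X -> inv_lim) (x0 : X) :
  (forall n, \forall x \near x0, inv_lim_coord (h x) n = inv_lim_coord (h x0) n) ->
  h x @[x --> x0] --> h x0.
Proof.
move=> hP U [_ [[W oW <-] Wh sU]]; apply: filterS sU _.
have : val (h x) @[x --> x0] --> val (h x0).
  apply/cvg_sup => i A [_ [[B oB <-] Bx sB]]; apply: filterS sB _.
  by apply: filterS (hP i) => x /= E; move: Bx; rewrite /= -[val _ i]E.
apply; exact: open_nbhs_nbhs.
Qed.

Let mul_cont : continuous (fun x : inv_lim * inv_lim => (x.1 * x.2)%g).
Proof.
move=> [x y]; apply: inv_lim_cvg => n.
exists ([set z | inv_lim_coord z n = inv_lim_coord x n],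
        [set z | inv_lim_coord z n = inv_lim_coord y n]) => /=.
  by split; exact: inv_lim_coord_near.
move=> [x' y'] [/= ex ey].
by rewrite -[LHS]/(inv_lim_coord x' n * inv_lim_coord y' n)%g ex ey.
Qed.

Let inv_cont : continuous (fun x : inv_lim => x^-1%g).
Proof.
move=> x; apply: inv_lim_cvg => n; apply: filterS (inv_lim_coord_near x n) => y e.
by rewrite -[LHS]/(inv_lim_coord y n)^-1%g e.
Qed.

HB.instance Definition _ := isTopologicalGroup.Build inv_lim mul_cont inv_cont.

End InverseLimit.

Record tree := Tree {
  tree_set : set (seq nat);
  tree_nonempty : tree_set !=set0;
  tree_prefix : forall s t, prefix s t -> tree_set t -> tree_set s }.

Definition pruned (T : tree) : Prop :=
  forall s, tree_set T s -> exists t, [/\ tree_set T t, prefix s t & t != s].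

Definition level (T : tree) (n : nat) : set (seq nat) :=
  [set s | tree_set T s /\ size s = n].

Fact level_pred_subproof (T : tree) (n : nat) (s : level T n.+1) :
  level T n (take n (val s)).
Proof.
have [Ts sz] := set_valP s; split; last by rewrite size_takel // sz.
by apply: tree_prefix Ts; exact: prefix_take.
Qed.

Definition level_pred (T : tree) (n : nat) (s : level T n.+1) : level T n :=
  exist (fun t => t \in level T n) _ (mem_set (level_pred_subproof s)).

Definition G_tree (p : nat) (T : tree) : Type :=
  @inv_lim (fun n => L p (level T n.+1))
           (fun n => @L_map p _ _ (@level_pred T n.+1)).

HB.instance Definition _ p T := TopologicalGroup.on (G_tree p T).

Definition branches (T : tree) : set (nat -> nat) :=
  [set x | forall n, tree_set T (mkseq x n)].

(* The distance is valued in [R], so the space carries [R] as a parameter. *)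
Definition branch_space (R : realType) (T : tree) : Type := set_type (branches T).

HB.instance Definition _ R T := Choice.on (branch_space R T).

Section BranchMetric.
Local Open Scope ring_scope.
Variables (R : realType) (T : tree).
Implicit Types x y z : branch_space R T.

Definition branch_dist x y : R :=
  if pselect (exists n, val x n != val y n) is left xy
  then 2 ^- ex_minn xy else 0.

Let dist_small x y n : (forall i, (i < n)%N -> val x i = val y i) -> branch_dist x y <= 2 ^- n.
Proof.
rewrite /branch_dist; case: pselect => [xy h|_ _]; last by rewrite invr_ge0 exprn_ge0.
case: ex_minnP => m xym _; rewrite lef_pV2 ?posrE ?exprn_gt0 //.
rewrite ler_weXn2l ?ler1n // leqNgt; apply/negP => /h/eqP.
by rewrite (negbTE xym).
Qed.

Let distxx x : branch_dist x x = 0.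
Proof. by rewrite /branch_dist; case: pselect => // xx; exfalso; case: xx => n; rewrite eqxx. Qed.

Let dist_ge0 x y : 0 <= branch_dist x y.
Proof. by rewrite /branch_dist; case: pselect => *; rewrite ?invr_ge0 ?exprn_ge0. Qed.

Let dist_pos x y : branch_dist x y = 0 -> x = y.
Proof.
rewrite /branch_dist; case: pselect => [xy /eqP|xy _].
  by rewrite invr_eq0 expf_eq0 pnatr_eq0 andbF.
apply/val_inj/funext => n; apply: contra_notP xy => /eqP xyn; by exists n.
Qed.

Let distP x y : x = y \/ exists n, [/\ branch_dist x y = 2 ^- n,
  val x n != val y n & forall i, (i < n)%N -> val x i = val y i].
Proof.
rewrite /branch_dist; case: pselect => [xy|xy].
  right; case: ex_minnP => n xyn nmin; exists n; split=> // i lt_in.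
  by apply/eqP; apply: contraLR lt_in; rewrite -leqNgt; exact: nmin.
left; apply/val_inj/funext => n; apply: contra_notP xy => /eqP xyn; by exists n.
Qed.

Let dist_sym x y : branch_dist x y = branch_dist y x.
Proof.
rewrite /branch_dist; case: pselect => xy; case: pselect => yx //.
- congr (2 ^- _); apply: eq_ex_minn => n; congr (~~ _); exact: eq_sym.
- by case: yx; case: xy => n; exists n; rewrite eq_sym.
- by case: xy; case: yx => n; exists n; rewrite eq_sym.
Qed.

Let dist_triangle y x z : branch_dist x z <= branch_dist x y + branch_dist y z.
Proof.
wlog le : x z / branch_dist x y <= branch_dist y z => [wl|].
  have [/wl//|/ltW] := leP (branch_dist x y) (branch_dist y z).
  by rewrite (dist_sym x z) addrC (dist_sym y z) (dist_sym x y) => /wl.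
apply: (@le_trans _ _ (branch_dist y z)); last by rewrite lerDr.
move: le.
have [yz|[n [-> _ yz]]] := distP y z; first by rewrite -yz.
have [xy|[m [-> _ xy]]] := distP x y; first by rewrite xy => _; exact: dist_small.
rewrite lef_pV2 ?posrE ?exprn_gt0 // ler_eXn2l ?ltr1n // => nm.
by apply: dist_small => i lt_in; rewrite xy ?yz // (leq_trans lt_in).
Qed.

HB.instance Definition _ := isMetric.Build R (branch_space R T)
  distxx dist_pos dist_sym dist_triangle.

End BranchMetric.

Definition uniformly_homeomorphic (X Y : uniformType) : Prop :=
  exists (f : X -> Y) (g : Y -> X),
    [/\ cancel f g, cancel g f, unif_continuous f & unif_continuous g].

(* Main.v *)
(* Sending all generators but two to 1 defines homomorphisms from L(X) to the
   Heisenberg group over F_p, which exist as p is odd. They show that the center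
   of L(X) is the kernel of the coordinate map to F_p^(X + X), and that two
   commuting elements, independent modulo the center, span modulo the center the
   plane <a_v, b_v> of a single v in X. Passing to the limit, the branches x of T
   correspond to the maximal commuting planes <a_x, b_x> of G_T modulo its
   center, so an isomorphism G_T -> G_U induces a bijection of branches; it is
   uniformly continuous because x agrees with y up to level n exactly when a_x
   and a_y have the same image in L(T_n).

   Conversely, a uniformly continuous map [T] -> [U] induces maps T_k -> U_n as
   soon as k is a modulus of continuity for n, hence a continuous homomorphism
   G_T -> G_U, functorially. *)
Require Import Defs.
From HB Require Import structures.
From mathcomp Require Import all_boot all_order all_algebra.
From mathcomp Require Import monoid ring.
From mathcomp Require Import all_classical reals topology.

Set Implicit Arguments.
Unset Strict Implicit.
Unset Printing Implicit Defensive.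

Import Order.TTheory GRing.Theory Num.Theory.

Definition surjective (A B : Type) (f : A -> B) : Prop :=
  forall y, exists x, f x = y.

Section MultiplicativeTheory.
Local Open Scope group_scope.
Variables (G H : groupType) (f : {multiplicative G -> H}).

Lemma multiplicative1 : f 1 = 1.
Proof. by apply: (@mulgI _ (f 1)); rewrite -gmulfM !mulg1. Qed.

Lemma multiplicativeV x : f x^-1 = (f x)^-1.
Proof. by apply: (@mulgI _ (f x)); rewrite -gmulfM !mulgV multiplicative1. Qed.

Lemma multiplicativeX n x : f (x ^+ n) = f x ^+ n.
Proof.
by elim: n => [|n IH]; rewrite ?expg0 ?multiplicative1 // !expgS gmulfM IH.
Qed.

Lemma multiplicativeR x y : f [~ x, y] = [~ f x, f y].
Proof. by rewrite !gmulfM !multiplicativeV. Qed.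

Lemma subgroup_gen_ker (S : set G) :
  (forall x, S x -> f x = 1) -> forall x, subgroup_gen S x -> f x = 1.
Proof.
move=> fS; suff sub : (subgroup_gen S `<=` [set x | f x = 1])%classic by [].
apply: smallest_sub => //; split=> [|x y /= fx fy]; first exact: multiplicative1.
by rewrite gmulfM multiplicativeV fx fy mulgV.
Qed.

End MultiplicativeTheory.

Section QuotientLift.
Local Open Scope quotient_scope.
Local Open Scope group_scope.
Variables (G H : groupType) (N : normal_subgroup G).
Variable f : {multiplicative G -> H}.
Hypothesis f_trivial : forall x, normal_set N x -> f x = 1.

Let quot_lift_fun (x : quot_group N) : H := f (repr x).

Let quot_lift_pi x : quot_lift_fun (\pi x) = f x.
Proof.
have /f_trivial := quot_repr N x; rewrite gmulfM multiplicativeV => /mulg1_eq.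
by rewrite invgK.
Qed.

Let quot_lift_funM : {morph quot_lift_fun : x y / x * y}.
Proof. by move=> x y; rewrite -[LHS]/(quot_lift_fun (\pi _)) quot_lift_pi gmulfM. Qed.

Definition quot_lift : {multiplicative quot_group N -> H} :=
  HB.pack quot_lift_fun (isMultiplicative.Build _ _ _ quot_lift_funM).

Lemma quot_liftE x : quot_lift (\pi_(quot_group N) x) = f x.
Proof. exact: quot_lift_pi. Qed.

End QuotientLift.

Section ExpgTheory.
Local Open Scope group_scope.
Variables (G : groupType) (p : nat) (x : G).
Hypothesis xp : x ^+ p = 1.

Lemma expg_pred : (0 < p)%N -> x ^+ p.-1 = x^-1.
Proof. by move=> p_gt0; apply/esym/mulg1_eq; rewrite -expgS prednK. Qed.

Lemma expg_mod n : x ^+ (n %% p) = x ^+ n.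
Proof. by rewrite {2}(divn_eq n p) expgnDr mulnC expgnA xp expg1n mul1g. Qed.

Lemma expg_dvd n : p %| n -> x ^+ n = 1.
Proof. by move=> /eqP n0; rewrite -expg_mod n0. Qed.

End ExpgTheory.

Section ModuloCenter.
Local Open Scope group_scope.

Section PlaneTheory.
Variable G : groupType.
Implicit Types g h x y z : G.

Definition central z : Prop := forall g, commute z g.

(* The span and the linear independence over F_p of [g] and [h] modulo the
   center. *)
Definition plane g h x : Prop :=
  exists a b z, central z /\ x = g ^+ a * h ^+ b * z.

Definition independent (p : nat) g h : Prop :=
  forall a b : nat, central (g ^+ a * h ^+ b) -> p %| a /\ p %| b.

Lemma central1 : central 1.
Proof. by move=> g; exact/commute_sym/commute1. Qed.

Lemma centralM x y : central x -> central y -> central (x * y).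
Proof. by move=> cx cy g; apply/commute_sym/commuteM; exact/commute_sym. Qed.

Lemma centralV x : central x -> central x^-1.
Proof. by move=> cx g; exact/commute_sym/commuteV/commute_sym. Qed.

Lemma plane_central g h z : central z -> plane g h z.
Proof. by move=> cz; exists 0%N, 0%N, z; rewrite !mul1g. Qed.

Lemma plane_genl g h : plane g h g.
Proof. by exists 1%N, 0%N, 1; rewrite !mulg1; split=> //; exact: central1. Qed.

Lemma plane_genr g h : plane g h h.
Proof. by exists 0%N, 1%N, 1; rewrite mul1g mulg1; split=> //; exact: central1. Qed.

Lemma planeM g h x y :
  commute g h -> plane g h x -> plane g h y -> plane g h (x * y).
Proof.
move=> cgh [a [b [z [cz ->]]]] [a' [b' [z' [cz' ->]]]].
exists (a + a')%N, (b + b')%N, (z * z'); split; first exact: centralM.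
rewrite !expgnDr -!mulgA; congr (_ * _).
by rewrite (cz (_ * (_ * z'))) -!mulgA -(cz z') !mulgA (commuteX2 a' b cgh).
Qed.

Lemma planeX g h x n : commute g h -> plane g h x -> plane g h (x ^+ n).
Proof.
move=> cgh xP; elim: n => [|n IH]; first exact/plane_central/central1.
by rewrite expgS; exact: planeM.
Qed.

Lemma planeV p g h x :
  (0 < p)%N -> x ^+ p = 1 -> commute g h -> plane g h x -> plane g h x^-1.
Proof. by move=> p_gt0 xp cgh xP; rewrite -(expg_pred xp p_gt0); exact: planeX. Qed.

Lemma plane_trans g h g' h' x : commute g' h' ->
  plane g' h' g -> plane g' h' h -> plane g h x -> plane g' h' x.
Proof.
move=> cgh' gP hP [a [b [z [cz ->]]]].
by do !apply: planeM => //; [exact: planeX|exact: planeX|exact: plane_central].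
Qed.

Lemma independent_noncentral p g h : (1 < p)%N -> independent p g h -> ~ central g.
Proof.
move=> p_gt1 indep cg; have [] := indep 1%N 0%N; first by rewrite mulg1.
by rewrite dvdn1 gtn_eqF.
Qed.

End PlaneTheory.

Section Morphisms.
Variables (G H : groupType) (f : {multiplicative G -> H}).
Implicit Types g h x : G.

Lemma central_morph_inj x : injective f -> central (f x) -> central x.
Proof. by move=> f_inj cx g; apply: f_inj; rewrite !gmulfM; exact: cx. Qed.

Lemma independent_morph_inj p g h :
  injective f -> independent p g h -> independent p (f g) (f h).
Proof.
move=> f_inj indep a b; rewrite -!multiplicativeX -gmulfM => c.
exact: indep (central_morph_inj f_inj c).
Qed.

Hypothesis f_surj : surjective f.

Lemma central_morph x : central x -> central (f x).
Proof. by move=> cx y; have [g <-] := f_surj y; rewrite /commute -!gmulfM cx. Qed.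

Lemma plane_morph g h x : plane g h x -> plane (f g) (f h) (f x).
Proof.
move=> [a [b [z [cz ->]]]]; exists a, b, (f z); split; first exact: central_morph.
by rewrite !gmulfM !multiplicativeX.
Qed.

Lemma independent_of_morph p g h : independent p (f g) (f h) -> independent p g h.
Proof.
move=> indep a b /central_morph; rewrite gmulfM !multiplicativeX; exact: indep.
Qed.

Lemma plane_central_of_morph p g h x : (forall y : G, y ^+ p = 1) ->
  independent p (f g) (f h) -> plane g h x -> central (f x) -> central x.
Proof.
move=> G_exp indep [a [b [z [cz ->]]]] c.
have /indep[pa pb] : central (f g ^+ a * f h ^+ b).
  have := centralM c (centralV (central_morph cz)).
  by rewrite -multiplicativeV -gmulfM mulgK gmulfM !multiplicativeX.
by rewrite (expg_dvd (G_exp g) pa) (expg_dvd (G_exp h) pb) !mul1g.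
Qed.

End Morphisms.
End ModuloCenter.

Section Nil2Words.
Local Open Scope group_scope.
Variables (p : nat) (G : groupType) (G_nil2 : in_nil2_variety p G).

Lemma commg_central (x y : G) : central [~ x, y].
Proof. by move=> z; apply/commgP/eqP; exact: G_nil2.2. Qed.

Variables (I : eqType) (f : I -> G).
Implicit Types (i : I) (s : seq I).

Lemma prodg_extract i s : exists2 z, central z &
  \prod_(j <- s) f j = f i ^+ count_mem i s * \prod_(j <- s | j != i) f j * z.
Proof.
elim: s => [|j s [z cz IH]].
  by exists 1; [exact: central1 | rewrite !big_nil !mulg1].
rewrite !big_cons /= IH; case: eqP => [->|ji] /=.
  by exists z => //; rewrite add1n expgS !mulgA.
have := commg_central (f j) (f i ^+ count_mem i s).
have := commgC (f j) (f i ^+ count_mem i s); move: [~ _, _] => r fjiE cr.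
exists (r * z); first exact: centralM.
by rewrite add0n !mulgA fjiE -[_ * r * _]mulgA cr !mulgA.
Qed.

Lemma prodg_central s :
  (forall i, p %| count_mem i s) -> central (\prod_(i <- s) f i).
Proof.
have [n] := ubnP (size s); elim: n s => // n IH [|i s] /=.
  by rewrite big_nil => _ _; exact: central1.
rewrite ltnS => sn ps; have [z cz ->] := prodg_extract i (i :: s).
rewrite (expg_dvd (G_nil2.1 _) (ps i)) mul1g; apply: centralM => //.
rewrite big_cons eqxx -big_filter; apply: IH => [|k].
  by rewrite (leq_trans _ sn) // ltnS size_filter count_size.
rewrite count_filter; have [->|ki] := eqVneq k i.
  by rewrite (@eq_count _ _ pred0) ?count_pred0 // => l /=; case: eqP.
rewrite (@eq_count _ _ (pred1 k)); last by move=> l /=; case: eqP => // ->.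
by have := ps k; rewrite /= eq_sym (negbTE ki).
Qed.

End Nil2Words.

Section Heisenberg.
Local Open Scope ring_scope.
Variable F : comNzRingType.

(* The matrix [[1, x, z], [0, 1, y], [0, 0, 1]] is encoded as ((x, y), z). *)
Definition heis : Type := (F * F * F)%type.

HB.instance Definition _ := Choice.on heis.

Definition heis_mul (g h : heis) : heis :=
  ((g.1.1 + h.1.1, g.1.2 + h.1.2), g.2 + h.2 + g.1.1 * h.1.2).
Definition heis_one : heis := ((0, 0), 0).
Definition heis_inv (g : heis) : heis :=
  ((- g.1.1, - g.1.2), - g.2 + g.1.1 * g.1.2).

Lemma heis_eq (g h : heis) :
  g.1.1 = h.1.1 -> g.1.2 = h.1.2 -> g.2 = h.2 -> g = h.
Proof. by case: g h => [[x y] z] [[x' y'] z'] /= -> -> ->. Qed.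

Let mulA : associative heis_mul.
Proof. by move=> g h k; apply: heis_eq => /=; ring. Qed.
Let mul1 : left_id heis_one heis_mul.
Proof. by move=> g; apply: heis_eq => /=; ring. Qed.
Let mulr1 : right_id heis_one heis_mul.
Proof. by move=> g; apply: heis_eq => /=; ring. Qed.
Let mulV : left_inverse heis_one heis_inv heis_mul.
Proof. by move=> g; apply: heis_eq => /=; ring. Qed.
Let mulrV : right_inverse heis_one heis_inv heis_mul.
Proof. by move=> g; apply: heis_eq => /=; ring. Qed.

HB.instance Definition _ := isGroup.Build heis mulA mul1 mulr1 mulV mulrV.

Lemma heis_commute (g h : heis) :
  commute g h <-> g.1.1 * h.1.2 = h.1.1 * g.1.2.
Proof.
split=> [|e]; last by apply: heis_eq => /=; ring: e.
move/(congr1 (fun k : heis => k.2)) => /=.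
by rewrite [h.2 + _]addrC => /addrI.
Qed.

Lemma heisX (g : heis) n :
  (g ^+ n)%g = ((g.1.1 *+ n, g.1.2 *+ n),
                g.2 *+ n + (g.1.1 * g.1.2) *+ 'C(n, 2)) :> heis.
Proof.
elim: n => [|n IH]; first by rewrite addr0.
rewrite expgS IH binS bin1; apply: heis_eq => /=; rewrite ?mulrS //.
rewrite mulrnDr mulrnAr; ring.
Qed.

Lemma heis_nil2_variety p : p \in [pchar F] -> odd p -> in_nil2_variety p heis.
Proof.
move=> charp oddp; split=> [g|g h k].
  rewrite heisX !(mulrn_pchar charp) add0r.
  have p_prime := pcharf_prime charp.
  have p_gt2 : (2 < p)%N.
    by rewrite ltn_neqAle prime_gt1 // andbT; apply: contraTneq oddp => <-.
  have /dvdnP[m ->] : (p %| 'C(p, 2))%N by exact: prime_dvd_bin.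
  by rewrite mulnC mulrnA (mulrn_pchar charp) mul0rn.
apply/eqP/commgP/heis_commute => /=; ring.
Qed.

End Heisenberg.

Section LTheory.
Local Open Scope quotient_scope.
Local Open Scope group_scope.
Variables (p : nat) (X : Type).

Lemma L_ind (P : L p X -> Prop) :
    P 1 -> (forall i, P (L_gen p i)) ->
    (forall x y, P x -> P y -> P (x * y)) -> (forall x, P x -> P x^-1) ->
  forall x, P x.
Proof.
move=> P1 Pg PM PV x; rewrite -[x]reprK -[repr x]reprK.
elim: (repr (repr x)) => [i||s IHs t IHt|s IHs]; [exact: Pg|exact: P1| |].
- have -> : \pi_(nil2 p (X + X)) (GMul s t) =
    \pi_(nil2 p (X + X)) s * \pi_(nil2 p (X + X)) t by exact/esym/nil2_piM.
  by rewrite L_piM; exact: PM.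
- have -> : \pi_(nil2 p (X + X)) (GInv s) = (\pi_(nil2 p (X + X)) s)^-1
    by exact/esym/nil2_piV.
  by rewrite L_piV; exact: PV.
Qed.

Lemma L_morph_eq (G : groupType) (f g : {multiplicative L p X -> G}) :
  (forall i, f (L_gen p i) = g (L_gen p i)) -> f =1 g.
Proof.
move=> fg; apply: L_ind => [|//|x y|x]; first by rewrite !multiplicative1.
  by rewrite !gmulfM => -> ->.
by rewrite !multiplicativeV => ->.
Qed.

Lemma L_morph_surj (G : groupType) (f : {multiplicative G -> L p X}) :
  (forall i, exists x, f x = L_gen p i) -> surjective f.
Proof.
move=> f_gen; apply: L_ind => [|//|_ _ [x <-] [y <-]|_ [x <-]].
- by exists 1; exact: multiplicative1.
- by exists (x * y); exact: gmulfM.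
- by exists x^-1; exact: multiplicativeV.
Qed.

Lemma L_mul_ind (P : L p X -> Prop) : (0 < p)%N ->
    P 1 -> (forall i, P (L_gen p i)) ->
    (forall x y, P x -> P y -> P (x * y)) ->
  forall x, P x.
Proof.
move=> p_gt0 P1 Pg PM; apply: L_ind => // x Px.
rewrite -(expg_pred ((L_variety p X).1 x) p_gt0).
by elim: p.-1 => [|n IH]; rewrite ?expg0 // expgS; exact: PM.
Qed.

Lemma L_prod_gen x : (0 < p)%N ->
  exists (s : seq (X + X)) z, central z /\ x = \prod_(i <- s) L_gen p i * z.
Proof.
move=> p_gt0; elim/L_mul_ind: x => //.
- by exists [::], 1; rewrite big_nil mulg1; split=> //; exact: central1.
- by move=> i; exists [:: i], 1; rewrite big_seq1 mulg1; split=> //; exact: central1.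
move=> _ _ [s [y [cy ->]]] [t [z [cz ->]]].
exists (s ++ t), (y * z); split; first exact: centralM.
by rewrite big_cat -!mulgA; congr (_ * _); rewrite !mulgA cy.
Qed.

Section Lift.
Variables (G : groupType) (f : X + X -> G).
Hypothesis G_nil2 : in_nil2_variety p G.
Hypothesis f_comm : forall v, commute (f (inl v)) (f (inr v)).

Let nil2_lift_morph : {multiplicative nil2 p (X + X) -> G} :=
  HB.pack (nil2_lift (p := p) f) (isMultiplicative.Build _ _ _ (nil2_liftM f G_nil2)).

Let nil2_lift_relators x :
  normal_set (L_subgroup p X) x -> nil2_lift_morph x = 1.
Proof.
apply: subgroup_gen_ker => {x} _ [v _ <-]; rewrite multiplicativeR /=.
by rewrite !(nil2_lift_gen f G_nil2); exact/eqP/commgP/f_comm.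
Qed.

Definition L_lift : {multiplicative L p X -> G} := quot_lift nil2_lift_relators.

Lemma L_lift_gen i : L_lift (L_gen p i) = f i.
Proof. by rewrite [LHS]quot_liftE /= nil2_lift_gen. Qed.

End Lift.

End LTheory.

Section LCoord.
Local Open Scope ring_scope.
Variables (p : nat) (p_prime : prime p) (p_odd : odd p) (X : eqType).
Implicit Types (i j k : X + X) (x y z : L p X) (v w : X).

Definition partner i : X + X :=
  match i with inl v => inr v | inr v => inl v end.

Definition gen_vertex i : X := match i with inl v | inr v => v end.

Lemma partnerK : involutive partner. Proof. by case. Qed.

Lemma neq_partner i : i != partner i. Proof. by case: i. Qed.

Lemma gen_vertex_partner i : gen_vertex (partner i) = gen_vertex i.
Proof. by case: i. Qed.

Definition gen_to_heis i j k : heis 'F_p := (((k == i)%:R, (k == j)%:R), 0).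

Lemma gen_to_heis_commute i j : j != partner i ->
  forall v, commute (gen_to_heis i j (inl v)) (gen_to_heis i j (inr v)).
Proof.
move=> ji v; apply/heis_commute; rewrite /= -!natrM !mulnb.
by congr (_%:R); congr nat_of_bool; apply/andP/andP => -[/eqP vi /eqP vj];
  rewrite -vi -vj eqxx in ji.
Qed.

Definition L_to_heis i j (ji : j != partner i) :
    {multiplicative L p X -> heis 'F_p} :=
  L_lift (heis_nil2_variety (pchar_Fp p_prime) p_odd) (gen_to_heis_commute ji).

Definition L_coord i x : 'F_p := (L_to_heis (neq_partner i) x).1.1.

Lemma L_coord1 i : L_coord i 1%g = 0.
Proof. by rewrite /L_coord multiplicative1. Qed.

Lemma L_coordM i x y : L_coord i (x * y)%g = L_coord i x + L_coord i y.
Proof. by rewrite /L_coord gmulfM. Qed.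

Lemma L_coordV i x : L_coord i x^-1%g = - L_coord i x.
Proof. by rewrite /L_coord multiplicativeV. Qed.

Lemma L_coordX i x n : L_coord i (x ^+ n)%g = L_coord i x *+ n.
Proof.
by elim: n => [|n IH]; rewrite ?expg0 ?L_coord1 // expgS L_coordM IH mulrS.
Qed.

Lemma L_coord_gen i k : L_coord i (L_gen p k) = (k == i)%:R.
Proof. by rewrite /L_coord L_lift_gen. Qed.

Lemma L_coord_prod_gen i s :
  L_coord i (\prod_(k <- s) L_gen p k)%g = (count_mem i s)%:R.
Proof.
elim: s => [|k s IH]; first by rewrite big_nil L_coord1.
by rewrite big_cons L_coordM L_coord_gen IH /= natrD.
Qed.

Lemma L_to_heisE i j (ji : j != partner i) x :
  (L_to_heis ji x).1 = (L_coord i x, L_coord j x).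
Proof.
elim/L_ind: x => [|k|x y IHx IHy|x IHx].
- by rewrite multiplicative1 !L_coord1.
- by rewrite L_lift_gen !L_coord_gen.
- by rewrite gmulfM !L_coordM /= IHx IHy.
- by rewrite multiplicativeV !L_coordV /= IHx.
Qed.

Lemma commute_L_coord i j x y : commute x y -> j != partner i ->
  L_coord i x * L_coord j y = L_coord i y * L_coord j x.
Proof.
move=> cxy ji; have /heis_commute : commute (L_to_heis ji x) (L_to_heis ji y).
  exact: gmulf_commute.
by rewrite !L_to_heisE.
Qed.

Hypothesis X_nontrivial : forall v, exists w, w != v.

Lemma central_L_coord x i : central x -> L_coord i x = 0.
Proof.
move=> cx; have [j ji jpi] : exists2 j, j != i & j != partner i.
  by case: i => v; have [w wv] := X_nontrivial v; [exists (inl w)|exists (inr w)];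
    rewrite ?eqE.
have := commute_L_coord (cx (L_gen p j)) jpi.
by rewrite !L_coord_gen eqxx (negbTE ji) mulr1 mul0r.
Qed.

Lemma L_centralP x : central x <-> forall i, L_coord i x = 0.
Proof.
split=> [cx i|]; first exact: central_L_coord.
have [s [z [cz ->]]] := L_prod_gen x (prime_gt0 p_prime) => sz0.
apply: (centralM _ cz); apply: (prodg_central (L_variety p X)) => i.
rewrite (dvdn_pcharf (pchar_Fp p_prime)) -L_coord_prod_gen.
by have := sz0 i; rewrite L_coordM (central_L_coord i cz) addr0 => ->.
Qed.

Definition L_plane v x := plane (L_gen p (inl v)) (L_gen p (inr v)) x.

Lemma L_coord_plane v a b i :
  L_coord i (L_gen p (inl v) ^+ a * L_gen p (inr v) ^+ b)%g =
  (inl v == i)%:R *+ a + (inr v == i)%:R *+ b.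
Proof. by rewrite L_coordM !L_coordX !L_coord_gen. Qed.

Lemma L_planeP v x :
  L_plane v x <-> forall i, gen_vertex i != v -> L_coord i x = 0.
Proof.
have plane_coord u : L_plane v u -> forall i, gen_vertex i != v -> L_coord i u = 0.
  move=> [a [b [z [cz ->]]]] i iv.
  have neq j : gen_vertex j = v -> (j == i) = false.
    by move=> jv; apply: contraNF iv => /eqP<-; rewrite jv.
  by rewrite L_coordM L_coord_plane (central_L_coord i cz) !neq // !mul0rn !addr0.
split=> [|x0]; first exact: plane_coord.
pose a : nat := L_coord (inl v) x; pose b : nat := L_coord (inr v) x.
pose u := (L_gen p (inl v) ^+ a * L_gen p (inr v) ^+ b)%g.
exists a, b, (u^-1 * x)%g; split; last by rewrite mulVKg.
apply/L_centralP => i; rewrite L_coordM L_coordV.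
have [iv|iv] := eqVneq (gen_vertex i) v; last first.
  rewrite x0 // plane_coord ?oppr0 ?addr0 //.
  by exists a, b, 1%g; rewrite mulg1; split=> //; exact: central1.
rewrite L_coord_plane; case: i iv => w /= ->.
  by rewrite eqxx mul0rn addr0 natr_Zp addNr.
by rewrite eqxx mul0rn add0r natr_Zp addNr.
Qed.

Lemma L_gen_independent v :
  independent p (L_gen p (inl v)) (L_gen p (inr v)).
Proof.
move=> a b /L_centralP c0; have := c0 (inl v); have := c0 (inr v).
rewrite !L_coord_plane !eqxx !mul0rn addr0 add0r => /eqP b0 /eqP a0.
by rewrite !(dvdn_pcharf (pchar_Fp p_prime)).
Qed.

Lemma L_plane_inj v w x : L_plane v x -> L_plane w x -> ~ central x -> v = w.
Proof.
move=> /L_planeP vx /L_planeP wx ncx; apply: contra_notP ncx => /eqP vw.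
apply/L_centralP => i; have [iv|/vx//] := eqVneq (gen_vertex i) v.
by apply: wx; rewrite iv.
Qed.

(* A nonzero 2x2 minor of the coordinates of a commuting pair can only occur in
   columns a_v, b_v; every other column is then parallel to both of these. *)
Lemma L_commute_plane x y :
  commute x y -> independent p x y -> exists v, L_plane v x /\ L_plane v y.
Proof.
move=> cxy xy_indep.
have /existsNP[i /eqP xi] : ~ forall i, L_coord i x = 0.
  by move/L_centralP; apply: independent_noncentral xy_indep; exact: prime_gt1.
pose n : nat := - L_coord i y / L_coord i x.
have /existsNP[j yj] : ~ forall j, L_coord j (x ^+ n * y)%g = 0.
  by move/L_centralP => /(xy_indep n 1%N)[_]; rewrite dvdn1 gtn_eqF ?prime_gt1.
have minor : L_coord i x * L_coord j y - L_coord i y * L_coord j x != 0.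
  apply/eqP => minor0; apply: yj; rewrite L_coordM L_coordX -mulr_natl natr_Zp.
  by apply: (mulfI xi); rewrite mulr0 -minor0; field.
have {yj} ji : j = partner i.
  apply: contraNeq minor => ji.
  by rewrite (commute_L_coord cxy ji) subrr.
have parallel k : gen_vertex k != gen_vertex i ->
    L_coord i x * L_coord k y = L_coord i y * L_coord k x /\
    L_coord j x * L_coord k y = L_coord j y * L_coord k x.
  move=> ki; split; apply: commute_L_coord => //; apply: contraNneq ki => ->.
    by rewrite gen_vertex_partner.
  by rewrite ji partnerK.
exists (gen_vertex i); split; apply/L_planeP => k /parallel[ik jk];
  apply: (mulfI minor); rewrite mulr0.
  by ring: (esym ik) (esym jk).
by ring: ik jk.
Qed.

End LCoord.

Section LMapTheory.
Local Open Scope group_scope.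
Variables (p : nat) (X Y : Type) (q : X -> Y).

Lemma L_map_id (x : L p X) : L_map id x = x.
Proof.
by apply: (L_morph_eq (f := L_map (p := p) id) (g := idfun)) => -[v|v];
  exact: L_map_L_gen.
Qed.

Lemma L_map_comp (Z : Type) (r : Y -> Z) (x : L p X) :
  L_map r (L_map q x) = L_map (r \o q) x.
Proof.
apply: (L_morph_eq (f := L_map (p := p) r \o L_map (p := p) q)
  (g := L_map (p := p) (r \o q))) => i /=.
by rewrite !L_map_L_gen; case: i => v; exact: L_map_L_gen.
Qed.

End LMapTheory.

Lemma prefix_mkseq (A : eqType) (f : nat -> A) m n :
  m <= n -> prefix (mkseq f m) (mkseq f n).
Proof.
by move=> mn; rewrite prefixE size_mkseq -map_take take_iota (minn_idPl mn).
Qed.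

Section Branches.
Local Open Scope classical_set_scope.
Variable T : tree.
Implicit Types x y : branches T.

Definition branch_level x n : level T n :=
  exist (fun s => s \in level T n) (mkseq (val x) n)
    (mem_set (conj (set_valP x n) (size_mkseq (val x) n))).

Lemma level_pred_branch x n : level_pred (branch_level x n.+1) = branch_level x n.
Proof.
apply/val_inj/eqP; rewrite /= -[X in take X](size_mkseq (val x) n) -prefixE.
exact: prefix_mkseq.
Qed.

Lemma branch_level_eq x y n :
  branch_level x n = branch_level y n <-> forall i, (i < n)%N -> val x i = val y i.
Proof.
split=> [/(congr1 val) /= xy i lti|xy].
  by rewrite -(nth_mkseq 0 (val x) lti) xy nth_mkseq.
apply/val_inj/(@eq_from_nth _ 0); rewrite ?size_mkseq // => i lti.
by rewrite !nth_mkseq ?xy.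
Qed.

Lemma branch_level_le x y m n : (m <= n)%N ->
  branch_level x n = branch_level y n -> branch_level x m = branch_level y m.
Proof.
move=> mn /branch_level_eq xy; apply/branch_level_eq => i im.
by apply: xy; exact: leq_trans mn.
Qed.

Lemma branch_level_inj x y : (forall n, branch_level x n = branch_level y n) -> x = y.
Proof.
move=> xy; apply/val_inj/funext => n.
by have /branch_level_eq := xy n.+1; apply.
Qed.

Lemma branch_of_chain (s : nat -> seq nat) :
    (forall n, tree_set T (s n)) -> (forall n, prefix (s n) (s n.+1)) ->
    (forall n, n <= size (s n))%N ->
  exists x, forall n, mkseq (val x) (size (s n)) = s n.
Proof.
move=> sT s_succ s_size.
have s_prefix : {homo s : m n / (m <= n)%N >-> prefix m n}.
  apply: homo_leq s_succ; first exact: prefix_refl.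
  exact: prefix_trans.
have nth_s m n i : (m <= n)%N -> (i < size (s m))%N -> nth 0 (s n) i = nth 0 (s m) i.
  by move=> /s_prefix/prefixP[t ->] im; rewrite nth_cat im.
pose x i := nth 0 (s i.+1) i.
have xE n : mkseq x (size (s n)) = s n.
  apply: (@eq_from_nth _ 0); rewrite size_mkseq // => i ltis.
  rewrite nth_mkseq // /x -(nth_s _ _ _ (leq_maxl i.+1 n)) ?s_size //.
  by rewrite (nth_s _ _ _ (leq_maxr i.+1 n)).
have xT : x \in branches T.
  by apply/mem_set => n; apply: tree_prefix (sT n); rewrite -xE; exact: prefix_mkseq.
by exists (exist _ x xT).
Qed.

Lemma branch_of_levels N (v : forall n, level T (n + N).+1) :
  (forall n, level_pred (v n.+1) = v n) ->
  exists x, forall n, branch_level x (n + N).+1 = v n.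
Proof.
move=> vP; have szv n : size (val (v n)) = (n + N).+1 by have [] := set_valP (v n).
have [|n|n|x xv] := @branch_of_chain (fun n => val (v n)).
- by move=> n; have [] := set_valP (v n).
- by rewrite -(vP n); exact: prefix_take.
- by rewrite szv leqW // leq_addr.
by exists x => n; apply: val_inj => /=; rewrite -[RHS]xv szv.
Qed.

Hypothesis T_pruned : pruned T.

Lemma branch_through s :
  tree_set T s -> exists x : branches T, mkseq (val x) (size s) = s.
Proof.
have /choice[ext extP] : forall t, exists u, tree_set T t ->
    [/\ tree_set T u, prefix t u & size t < size u]%N.
  move=> t; have [Tt|] := pselect (tree_set T t); last by exists t.
  have [u [Tu tu ne]] := T_pruned Tt; exists u => _; split=> //.
  case/prefixP: tu ne => -[|k w] ->; first by rewrite cats0 eqxx.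
  by rewrite size_cat /= addnS ltnS leq_addr.
move=> Ts; have iterT n : tree_set T (iter n ext s).
  by elim: n => //= n /extP[].
have [n|n|n|x xs] := @branch_of_chain (fun n => iter n ext s).
- exact: iterT.
- by have [] := extP _ (iterT n).
- by elim: n => //= n IH; have [_ _] := extP _ (iterT n); exact: leq_ltn_trans.
- by exists x; exact: xs 0%N.
Qed.

Lemma branch_extend n (v : level T n) : exists x, branch_level x n = v.
Proof.
have [Tv szv] := set_valP v; have [x xv] := branch_through Tv.
by exists x; apply: val_inj => /=; rewrite -[RHS]xv szv.
Qed.

Lemma level_nontrivial n (v : level T n.+1) :
  infinite_set (level T 1) -> exists w, w != v.
Proof.
apply: contra_notP => /forallNP/= all_v.
apply: (@sub_finite_set _ _ [set take 1 (val v)]); last exact: finite_set1.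
move=> s Ts.
have [x xs] := branch_extend (exist (fun s => s \in level T 1) s (mem_set Ts)).
have xv : branch_level x n.+1 = v by apply/eqP/negPn/negP/all_v.
by rewrite -[s](congr1 val xs) -[val v](congr1 val xv) /mkseq /= take0.
Qed.

End Branches.

Section InverseLimitTheory.
Local Open Scope classical_set_scope.
Local Open Scope group_scope.
Variables (G : nat -> groupType) (f : forall n, {multiplicative G n.+1 -> G n}).
Implicit Types x y g h : inv_lim f.

Lemma inv_lim_coordM x y n :
  inv_lim_coord (x * y) n = inv_lim_coord x n * inv_lim_coord y n.
Proof. by []. Qed.

Definition inv_lim_proj n : {multiplicative inv_lim f -> G n} :=
  HB.pack (fun x : inv_lim f => inv_lim_coord x n)
    (isMultiplicative.Build _ _ _ (fun x y => inv_lim_coordM x y n)).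

Lemma inv_lim_exists (x : forall n, G n) : (forall n, f n (x n.+1) = x n) ->
  exists y : inv_lim f, forall n, inv_lim_coord y n = x n.
Proof.
by move=> xP; exists (exist (fun z => z \in inv_lim_set f) x (mem_set xP)).
Qed.

Lemma inv_lim_transition m n : (m <= n)%N ->
  exists F : {multiplicative G n -> G m},
    forall x, F (inv_lim_coord x n) = inv_lim_coord x m.
Proof.
move=> /subnK<-; elim: (n - m)%N => [|k [F FP]]; first by exists idfun.
by exists (F \o f (k + m)) => x /=; rewrite inv_limP FP.
Qed.

Lemma inv_lim_coord_le x y m n : (m <= n)%N ->
  inv_lim_coord x n = inv_lim_coord y n -> inv_lim_coord x m = inv_lim_coord y m.
Proof. by move=> /inv_lim_transition[F FP] xy; rewrite -!FP xy. Qed.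

Lemma inv_lim_nbhsP x (A : set (inv_lim f)) :
  nbhs x A <-> exists n, forall y, inv_lim_coord y n = inv_lim_coord x n -> A y.
Proof.
split=> [|[n nA]]; last exact: filterS nA (inv_lim_coord_near x n).
pose F : set_system (inv_lim f) :=
  [set B | exists n, forall y, inv_lim_coord y n = inv_lim_coord x n -> B y]%classic.
have FF : Filter F.
  split; first by exists 0%N.
    move=> B C [m mB] [n nC]; exists (maxn m n) => y yx; split.
      by apply: mB; exact: inv_lim_coord_le (leq_maxl m n) yx.
    by apply: nC; exact: inv_lim_coord_le (leq_maxr m n) yx.
  by move=> B C BC [n nB]; exists n => y /nB/BC.
suff : F --> x by exact.
have val_cvg : val @ F --> val x.
  apply/cvg_sup => n B [_ [[C oC <-] Cx CB]]; apply: filterS CB _.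
  by exists n => y yx; move: Cx; rewrite /= -[val _ n]yx.
move=> B [_ [[C oC <-] Cx CB]]; apply: filterS CB _; apply: val_cvg.
exact: open_nbhs_nbhs.
Qed.

Lemma inv_lim_commute x y :
  (forall n, commute (inv_lim_coord x n) (inv_lim_coord y n)) -> commute x y.
Proof. by move=> xy; apply: inv_lim_inj => n; exact: xy. Qed.

Lemma inv_lim_coordX x k n : inv_lim_coord (x ^+ k) n = inv_lim_coord x n ^+ k.
Proof. exact: (multiplicativeX (inv_lim_proj n)). Qed.

Lemma inv_lim_coordV x n : inv_lim_coord x^-1 n = (inv_lim_coord x n)^-1.
Proof. by []. Qed.

Lemma inv_lim_expg1 p : (forall n (x : G n), x ^+ p = 1) -> forall x, x ^+ p = 1.
Proof.
move=> G_exp x; apply: inv_lim_inj => n.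
by rewrite inv_lim_coordX G_exp.
Qed.

Hypothesis coord_surj : forall n v, exists x : inv_lim f, inv_lim_coord x n = v.

Lemma inv_lim_map_surj n : surjective (f n).
Proof.
by move=> v; have [x <-] := coord_surj v; exists (inv_lim_coord x n.+1); exact: inv_limP.
Qed.

Lemma inv_lim_centralP x : central x <-> forall n, central (inv_lim_coord x n).
Proof.
split=> [cx n|cx y].
  exact: (central_morph (f := inv_lim_proj n) (@coord_surj n)).
by apply: inv_lim_commute => n; exact: cx.
Qed.

Lemma inv_lim_transition_surj m n : (m <= n)%N ->
  exists2 F : {multiplicative G n -> G m}, surjective F &
    forall x, F (inv_lim_coord x n) = inv_lim_coord x m.
Proof.
move=> /inv_lim_transition[F FP]; exists F => // v.
by have [x <-] := coord_surj v; exists (inv_lim_coord x n).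
Qed.

Lemma inv_lim_central_le x m n : (m <= n)%N ->
  central (inv_lim_coord x n) -> central (inv_lim_coord x m).
Proof. by move=> /inv_lim_transition_surj[F F_surj <-]; exact: central_morph. Qed.

Lemma inv_lim_independent_le p g h m n : (m <= n)%N ->
  independent p (inv_lim_coord g m) (inv_lim_coord h m) ->
  independent p (inv_lim_coord g n) (inv_lim_coord h n).
Proof.
move=> /inv_lim_transition_surj[F F_surj FP]; rewrite -!FP.
exact: independent_of_morph.
Qed.

Variables (p : nat) (p_gt0 : (0 < p)%N).
Hypothesis G_exp : forall n (x : G n), x ^+ p = 1.

(* Only the finitely many exponents below p matter. *)
Lemma inv_lim_independent_coord g h : independent p g h ->
  exists n, independent p (inv_lim_coord g n) (inv_lim_coord h n).
Proof.
move=> indep.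
have /choice[N NP] : forall ab : 'I_p * 'I_p, exists n,
    central (inv_lim_coord (g ^+ ab.1 * h ^+ ab.2) n) ->
    central (g ^+ ab.1 * h ^+ ab.2).
  move=> [a b] /=.
  have [?|] := pselect (central (g ^+ a * h ^+ b)); first by exists 0%N.
  by move=> /inv_lim_centralP/existsNP[n nc]; exists n => /nc.
exists (\max_ab N ab)%N => a b c.
pose ab := (Ordinal (ltn_pmod a p_gt0), Ordinal (ltn_pmod b p_gt0)).
have expg_modp u k : u ^+ (k %% p) = u ^+ k :> inv_lim f.
  exact: (expg_mod (inv_lim_expg1 G_exp u)).
have : central (g ^+ a * h ^+ b).
  rewrite -(expg_modp g) -(expg_modp h); apply: (NP ab).
  apply: (inv_lim_central_le (leq_bigmax ab)).
  by rewrite !expg_modp inv_lim_coordM !inv_lim_coordX.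
exact: indep.
Qed.

Lemma inv_lim_plane g h x N : commute g h ->
    independent p (inv_lim_coord g N) (inv_lim_coord h N) ->
    (forall n, plane (inv_lim_coord g (n + N)) (inv_lim_coord h (n + N))
                     (inv_lim_coord x (n + N))) ->
  plane g h x.
Proof.
move=> cgh indep ghx; have [a [b [z [cz xN]]]] := ghx 0%N.
exists a, b, ((g ^+ a * h ^+ b)^-1 * x); split; last by rewrite mulVKg.
apply/inv_lim_centralP => n; set y := _ * x.
apply: (inv_lim_central_le (leq_addr N n)).
have [F F_surj FP] := inv_lim_transition_surj (leq_addl n N).
apply: (plane_central_of_morph F_surj _ _ (g := inv_lim_coord g (n + N))
    (h := inv_lim_coord h (n + N)) (p := p)) => //.
- by rewrite !FP.
- have cghn : commute (inv_lim_coord g (n + N)) (inv_lim_coord h (n + N)).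
    exact: (gmulf_commute (inv_lim_proj (n + N))).
  rewrite inv_lim_coordM inv_lim_coordV; apply: planeM => //.
  apply: (planeV p_gt0) => //; rewrite inv_lim_coordM !inv_lim_coordX.
  by apply: planeM => //; apply: planeX => //; [exact: plane_genl|exact: plane_genr].
by rewrite FP inv_lim_coordM xN inv_lim_coordV inv_lim_coordM !inv_lim_coordX mulKg.
Qed.

End InverseLimitTheory.

Lemma inv_lim_morph_unif_continuous (G H : nat -> groupType)
    (f : forall n, {multiplicative G n.+1 -> G n})
    (g : forall n, {multiplicative H n.+1 -> H n})
    (h : {multiplicative inv_lim f -> inv_lim g}) : continuous h ->
  forall n, exists m, forall x y, inv_lim_coord x m = inv_lim_coord y m ->
    inv_lim_coord (h x) n = inv_lim_coord (h y) n.
Proof.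
move=> h_cont n; have := h_cont 1%g _ (inv_lim_coord_near (h 1%g) n).
move=> /inv_lim_nbhsP[m hm]; exists m => x y xy; apply: divg1_eq.
rewrite -inv_lim_coordV -inv_lim_coordM -multiplicativeV -gmulfM.
rewrite (hm (x / y)%g) ?multiplicative1 //.
by rewrite inv_lim_coordM inv_lim_coordV xy mulgV.
Qed.

Definition is_modulus (T U : tree) (phi : branches T -> branches U) n m : Prop :=
  forall x y, branch_level x m = branch_level y m ->
    branch_level (phi x) n = branch_level (phi y) n.

Definition level_continuous (T U : tree) (phi : branches T -> branches U) : Prop :=
  forall n, exists m, is_modulus phi n m.

Definition level_homeomorphic (T U : tree) : Prop :=
  exists (phi : branches T -> branches U) (psi : branches U -> branches T),
    [/\ cancel phi psi, cancel psi phi, level_continuous phi & level_continuous psi].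

Section Moduli.
Variables T U : tree.
Implicit Types phi : branches T -> branches U.

Lemma is_modulus_le phi n m k :
  (m <= k)%N -> is_modulus phi n m -> is_modulus phi n k.
Proof. by move=> mk phi_m x y /(branch_level_le mk)/phi_m. Qed.

Lemma level_continuous_modulusS phi n :
  level_continuous phi -> exists m, is_modulus phi n m.+1.
Proof. by move=> /(_ n)[m phi_m]; exists m; exact: is_modulus_le phi_m. Qed.

Lemma is_modulus_id n m : (n <= m)%N -> is_modulus (@id (branches T)) n m.
Proof. by move=> nm x y; exact: branch_level_le. Qed.

Lemma is_modulus_comp (V : tree) (psi : branches U -> branches V) phi n m k :
  is_modulus psi n m -> is_modulus phi m k -> is_modulus (psi \o phi) n k.
Proof. by move=> psi_m phi_k x y /phi_k/psi_m. Qed.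

Lemma level_continuous_id : level_continuous (@id (branches T)).
Proof. by move=> n; exists n; exact: is_modulus_id. Qed.

Lemma level_continuous_comp (V : tree) (psi : branches U -> branches V) phi :
  level_continuous psi -> level_continuous phi -> level_continuous (psi \o phi).
Proof.
move=> psi_cont phi_cont n; have [m psi_m] := psi_cont n.
by have [k phi_k] := phi_cont m; exists k; exact: is_modulus_comp phi_k.
Qed.

End Moduli.

Section BranchMetric.
Local Open Scope ring_scope.
Variable R : realType.

Lemma branch_dist_le (T : tree) (x y : branch_space R T) n :
  branch_dist x y <= 2 ^- n <->
  branch_level (x : branches T) n = branch_level (y : branches T) n.
Proof.
rewrite /branch_dist; case: pselect => [xy|xy]; last first.
  rewrite invr_ge0 exprn_ge0 //; split=> // _.
  by apply/branch_level_eq => i _; apply: contra_notP xy => /eqP; exists i.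
case: ex_minnP => m xym m_min.
rewrite lef_pV2 ?posrE ?exprn_gt0 // ler_eXn2l ?ltr1n //.
split=> [nm|/branch_level_eq xy_n].
  apply/branch_level_eq => i lt_in; apply/eqP; apply: contraLR nm => /m_min mi.
  by rewrite -ltnNge (leq_ltn_trans mi).
by rewrite leqNgt; apply: contraNN xym => /xy_n/eqP.
Qed.

Lemma exists_pow2_lt (e : R) : 0 < e -> exists n, 2 ^- n < e.
Proof.
move=> e_gt0; exists (Num.bound e^-1).
by rewrite invf_plt ?posrE ?exprn_gt0 // upper_nthrootP.
Qed.

Lemma unif_continuous_levelP (T U : tree)
    (phi : branch_space R T -> branch_space R U) :
  unif_continuous phi <-> level_continuous phi.
Proof.
rewrite unif_continuousP; split=> [phi_unif n|phi_level e /exists_pow2_lt[n ne]].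
  have [|d /exists_pow2_lt[m md] phi_d] := phi_unif (2 ^- n).
    by rewrite invr_gt0 exprn_gt0.
  exists m => x y /branch_dist_le xy; apply/branch_dist_le/ltW.
  by apply: (phi_d (x, y)); exact: le_lt_trans md.
have [m phi_m] := phi_level n; exists (2 ^- m); first by rewrite invr_gt0 exprn_gt0.
move=> [x y] /ltW/branch_dist_le/phi_m/branch_dist_le xy.
exact: le_lt_trans ne.
Qed.

Lemma uniformly_homeomorphicP (T U : tree) :
  uniformly_homeomorphic (branch_space R T) (branch_space R U) <->
  level_homeomorphic T U.
Proof.
split=> -[phi [psi [phiK psiK phi_cont psi_cont]]]; exists phi, psi; split=> //;
  exact/unif_continuous_levelP.
Qed.

End BranchMetric.

Section GTree.
Local Open Scope group_scope.
Variables (p : nat) (T : tree) (T_pruned : pruned T).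
Implicit Types (g h z : G_tree p T) (x y : branches T).

Local Notation gcoord g n := (inv_lim_coord g n : L p (level T n.+1)).

Definition branch_gen (i : branches T + branches T) n : level T n + level T n :=
  match i with
  | inl x => inl (branch_level x n)
  | inr x => inr (branch_level x n)
  end.

Fact G_gen_subproof i : exists g, forall n, gcoord g n = L_gen p (branch_gen i n.+1).
Proof.
apply: inv_lim_exists => n; rewrite /= L_map_L_gen.
by case: i => x /=; rewrite level_pred_branch.
Qed.

Definition G_gen i : G_tree p T := projT1 (cid (G_gen_subproof i)).

Lemma G_genE i n : gcoord (G_gen i) n = L_gen p (branch_gen i n.+1).
Proof. exact: (projT2 (cid (G_gen_subproof i))). Qed.

Lemma G_gen_commute x : commute (G_gen (inl x)) (G_gen (inr x)).
Proof.
by apply: inv_lim_commute => n; rewrite !G_genE; apply/commgP/eqP/L_gen_comm.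
Qed.

Lemma G_coord_surj n (u : L p (level T n.+1)) : exists g, gcoord g n = u.
Proof.
apply: (L_morph_surj (f := inv_lim_proj _ n)) => -[v|v].
  by have [x <-] := branch_extend T_pruned v; exists (G_gen (inl x)); exact: G_genE.
by have [x <-] := branch_extend T_pruned v; exists (G_gen (inr x)); exact: G_genE.
Qed.

Lemma G_expg1 g : g ^+ p = 1.
Proof. by apply: inv_lim_expg1 => n u; exact: (L_variety p _).1. Qed.

Definition G_plane x g : Prop := plane (G_gen (inl x)) (G_gen (inr x)) g.

Lemma G_plane_coord x g n : G_plane x g -> L_plane (branch_level x n.+1) (gcoord g n).
Proof.
by move/(plane_morph (f := inv_lim_proj _ n) (@G_coord_surj n)); rewrite /= !G_genE.
Qed.

Lemma L_plane_level_pred n (v : level T n.+2) g :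
  L_plane v (gcoord g n.+1) -> L_plane (level_pred v) (gcoord g n).
Proof.
move/(plane_morph (inv_lim_map_surj G_coord_surj (n := n))).
by rewrite inv_limP /= !L_map_L_gen.
Qed.

Hypotheses (p_prime : prime p) (p_odd : odd p).
Hypothesis T1_infinite : infinite_set (level T 1).

Let level_neq n (v : level T n.+1) : exists w, w != v :=
  level_nontrivial T_pruned v T1_infinite.

Lemma G_plane_central_coord x g n :
  G_plane x g -> central (gcoord g n) -> central g.
Proof.
apply: (plane_central_of_morph (f := inv_lim_proj _ n) (@G_coord_surj n) G_expg1).
by rewrite /= !G_genE; exact: L_gen_independent.
Qed.

Lemma G_gen_independent x : independent p (G_gen (inl x)) (G_gen (inr x)).
Proof.
apply: (independent_of_morph (f := inv_lim_proj _ 0) (@G_coord_surj 0)).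
by rewrite /= !G_genE; exact: L_gen_independent.
Qed.

Lemma G_gen_noncentral x : ~ central (G_gen (inl x)).
Proof.
exact: (independent_noncentral (prime_gt1 p_prime) (@G_gen_independent x)).
Qed.

Lemma G_plane_level x y g h n : G_plane x g -> G_plane y h -> ~ central g ->
  gcoord g n = gcoord h n -> branch_level x n.+1 = branch_level y n.+1.
Proof.
move=> xg yh ncg gh.
apply: (L_plane_inj p_prime p_odd (@level_neq n) (x := gcoord g n)).
- exact: G_plane_coord.
- by rewrite gh; exact: G_plane_coord.
- by move/(G_plane_central_coord xg).
Qed.

Lemma G_plane_inj x y g : G_plane x g -> G_plane y g -> ~ central g -> x = y.
Proof.
move=> xg yg ncg; apply: branch_level_inj => n.
exact: branch_level_le (leqnSn n) (G_plane_level xg yg ncg erefl).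
Qed.

Lemma G_planeP N x g :
    (forall n, L_plane (branch_level x (n + N).+1) (gcoord g (n + N))) ->
  G_plane x g.
Proof.
move=> xg; apply: (inv_lim_plane G_coord_surj (prime_gt0 p_prime) _ (N := N)).
- by move=> n u; exact: (L_variety p _).1.
- exact: G_gen_commute.
- by rewrite !G_genE; exact: L_gen_independent.
- by move=> n; rewrite !G_genE; exact: xg.
Qed.

Lemma G_commute_plane g h : commute g h -> independent p g h ->
  exists x, G_plane x g /\ G_plane x h.
Proof.
move=> gh indep.
have [N indepN] := inv_lim_independent_coord G_coord_surj (prime_gt0 p_prime)
  (fun n => (L_variety p (level T n.+1)).1) indep.
have indep_coord n : independent p (gcoord g (n + N)) (gcoord h (n + N)).
  exact: (inv_lim_independent_le G_coord_surj (leq_addl n N) indepN).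
have vP n : {v : level T (n + N).+1 |
    L_plane v (gcoord g (n + N)) /\ L_plane v (gcoord h (n + N))}.
  apply/cid/(L_commute_plane p_prime p_odd (@level_neq (n + N))).
    exact: (gmulf_commute (inv_lim_proj _ (n + N))).
  exact: indep_coord.
pose v n := sval (vP n).
have vg n : L_plane (v n) (gcoord g (n + N)) := (svalP (vP n)).1.
have vh n : L_plane (v n) (gcoord h (n + N)) := (svalP (vP n)).2.
have [n|x xv] := @branch_of_levels T N v.
  apply: (L_plane_inj p_prime p_odd (@level_neq (n + N)) (x := gcoord g (n + N))).
  - exact: L_plane_level_pred (vg n.+1).
  - exact: vg.
  - exact: (independent_noncentral (prime_gt1 p_prime) (indep_coord n)).
by exists x; split; apply: (G_planeP (N := N)) => n; rewrite xv.
Qed.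

End GTree.

Section BijectiveMorphism.
Local Open Scope group_scope.
Variables (p : nat) (p_prime : prime p) (p_odd : odd p) (T U : tree).
Hypotheses (T_pruned : pruned T) (U_pruned : pruned U).
Hypothesis T1_infinite : infinite_set (level T 1).
Hypothesis U1_infinite : infinite_set (level U 1).

Lemma G_plane_map_cancel (f : G_tree p T -> G_tree p U) g
    (phi : branches T -> branches U) psi :
    (forall x u, G_plane x u -> G_plane (phi x) (f u)) ->
    (forall y v, G_plane y v -> G_plane (psi y) (g v)) ->
  cancel f g -> cancel phi psi.
Proof.
move=> phiP psiP fK x; have xa := plane_genl (G_gen p (inl x)) (G_gen p (inr x)).
apply/esym/(G_plane_inj T_pruned p_prime p_odd T1_infinite xa).
  by rewrite -[G_gen _ _]fK; apply/psiP/phiP.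
exact: G_gen_noncentral.
Qed.

Variable f : {multiplicative G_tree p T -> G_tree p U}.
Hypothesis f_inj : injective f.

Lemma G_morph_plane x : surjective f ->
  exists y, forall g, G_plane x g -> G_plane y (f g).
Proof.
move=> f_surj.
have indep := G_gen_independent T_pruned p_prime p_odd T1_infinite (x := x).
have [y [ya yb]] : exists y, G_plane y (f (G_gen p (inl x))) /\
                             G_plane y (f (G_gen p (inr x))).
  apply: G_commute_plane => //; first exact/gmulf_commute/G_gen_commute.
  exact: (independent_morph_inj f_inj indep).
exists y => g /(plane_morph f_surj).
exact: (plane_trans (@G_gen_commute p U y) ya yb).
Qed.

Lemma G_plane_map_level_continuous (phi : branches T -> branches U) :
    continuous f -> (forall x g, G_plane x g -> G_plane (phi x) (f g)) ->
  level_continuous phi.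
Proof.
move=> f_cont phiP n; have [m fm] := inv_lim_morph_unif_continuous f_cont n.
exists m.+1 => x y xy; apply: branch_level_le (leqnSn n) _.
have xa z : G_plane (phi z) (f (G_gen p (inl z))) by apply: phiP; exact: plane_genl.
apply: (G_plane_level U_pruned p_prime p_odd U1_infinite (xa x) (xa y)).
  by move/(central_morph_inj f_inj); exact: G_gen_noncentral.
by apply: fm; rewrite !G_genE /= xy.
Qed.

Lemma G_morph_branch_map : surjective f -> continuous f ->
  exists2 phi : branches T -> branches U, level_continuous phi &
    forall x g, G_plane x g -> G_plane (phi x) (f g).
Proof.
move=> f_surj f_cont.
have /choice[phi phiP] x : exists y, forall g, G_plane x g -> G_plane y (f g).
  exact: G_morph_plane.
by exists phi => //; exact: G_plane_map_level_continuous phiP.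
Qed.

End BijectiveMorphism.

Lemma isomorphic_level_homeomorphic (p : nat) (T U : tree) :
    prime p -> odd p -> pruned T -> pruned U ->
    infinite_set (level T 1) -> infinite_set (level U 1) ->
  topologically_isomorphic (G_tree p T) (G_tree p U) -> level_homeomorphic T U.
Proof.
move=> p_prime p_odd T_pruned U_pruned T1_infinite U1_infinite.
move=> [f [f' [fK f'K f_cont f'_cont]]].
pose g : {multiplicative G_tree p U -> G_tree p T} :=
  HB.pack f' (isMultiplicative.Build _ _ f' (can2_gmulfM fK f'K)).
have f_surj : surjective f by move=> v; exists (g v); exact: f'K.
have g_surj : surjective g by move=> u; exists (f u); exact: fK.
have [phi phi_cont phiP] := G_morph_branch_map p_prime p_odd T_pruned U_pruned
  T1_infinite U1_infinite (can_inj fK) f_surj f_cont.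
have [psi psi_cont psiP] := G_morph_branch_map p_prime p_odd U_pruned T_pruned
  U1_infinite T1_infinite (f := g) (can_inj f'K) g_surj f'_cont.
exists phi, psi; split=> //.
  exact: (G_plane_map_cancel p_prime p_odd T_pruned T1_infinite phiP psiP fK).
exact: (G_plane_map_cancel p_prime p_odd U_pruned U1_infinite psiP phiP f'K).
Qed.

Section LevelMap.
Variables (T U : tree) (T_pruned : pruned T) (phi : branches T -> branches U).

Definition level_extend n (v : level T n) : branches T :=
  projT1 (cid (branch_extend T_pruned v)).

Lemma level_extendK n (v : level T n) : branch_level (level_extend v) n = v.
Proof. exact: (projT2 (cid (branch_extend T_pruned v))). Qed.

(* Depends on the choice of extension unless [m] is a modulus for [n]. *)
Definition level_map n m (v : level T m) : level U n :=
  branch_level (phi (level_extend v)) n.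

Lemma level_map_branch n m x : is_modulus phi n m ->
  level_map n (branch_level x m) = branch_level (phi x) n.
Proof. by apply; exact: level_extendK. Qed.

Lemma level_pred_map n m (v : level T m) :
  level_pred (level_map n.+1 v) = level_map n v.
Proof. exact: level_pred_branch. Qed.

End LevelMap.

Arguments level_map {T U} T_pruned phi n m v.

Section LevelMapFunctor.
Variables (T U V : tree) (T_pruned : pruned T) (U_pruned : pruned U).

Lemma level_map_id n : level_map T_pruned id n n = id.
Proof. by apply/funext => v; exact: level_extendK. Qed.

Lemma level_map_id_pred n : level_map T_pruned id n n.+1 = @level_pred T n.
Proof.
by apply/funext => v; rewrite -{2}(level_extendK T_pruned v) level_pred_branch.
Qed.

Lemma level_map_comp (phi : branches T -> branches U)
    (psi : branches U -> branches V) n m k :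
  is_modulus psi n m ->
  level_map U_pruned psi n m \o level_map T_pruned phi m k =
  level_map T_pruned (psi \o phi) n k.
Proof. by move=> psi_m; apply/funext => v; exact: level_map_branch. Qed.

End LevelMapFunctor.

Section InducedMorphism.
Local Open Scope group_scope.
Variables (p : nat) (T U : tree) (T_pruned : pruned T).
Variable phi : branches T -> branches U.
Implicit Types g h : G_tree p T.

Lemma L_map_level_map_id n m g : (n <= m)%N ->
  L_map (level_map T_pruned id n.+1 m.+1) (inv_lim_coord g m) = inv_lim_coord g n.
Proof.
move=> /subnK<-; elim: (m - n)%N => [|k IH]; first by rewrite level_map_id L_map_id.
rewrite -[RHS]IH -[inv_lim_coord g (k + n)]inv_limP /= L_map_comp.
rewrite -(level_map_id_pred T_pruned) level_map_comp //.
by apply: is_modulus_id; rewrite ltnS leq_addl.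
Qed.

Lemma L_map_level_map n m k g : (m <= k)%N -> is_modulus phi n m.+1 ->
  L_map (level_map T_pruned phi n k.+1) (inv_lim_coord g k) =
  L_map (level_map T_pruned phi n m.+1) (inv_lim_coord g m).
Proof.
move=> mk phi_m; rewrite -(L_map_level_map_id g mk) L_map_comp.
by rewrite level_map_comp.
Qed.

Definition is_G_map g (h : G_tree p U) : Prop :=
  forall n k, is_modulus phi n.+1 k.+1 -> inv_lim_coord h n =
    L_map (level_map T_pruned phi n.+1 k.+1) (inv_lim_coord g k).

Definition G_map g : G_tree p U := xget 1 [set h | is_G_map g h]%classic.

Hypothesis phi_cont : level_continuous phi.

Lemma G_mapP g : is_G_map g (G_map g).
Proof.
apply: (xgetPex 1 (P := [set h | is_G_map g h]%classic)).
have /choice[m mP] n := level_continuous_modulusS n.+1 phi_cont.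
pose h n : L p (level U n.+1) :=
  L_map (level_map T_pruned phi n.+1 (m n).+1) (inv_lim_coord g (m n)).
have hE n k : is_modulus phi n.+1 k.+1 ->
    h n = L_map (level_map T_pruned phi n.+1 k.+1) (inv_lim_coord g k).
  move=> phi_k; rewrite -(L_map_level_map g (leq_maxr (m n) k) phi_k).
  by rewrite (L_map_level_map g (leq_maxl (m n) k) (mP n)).
have [n|h' h'E] := @inv_lim_exists _ (fun n => @L_map p _ _ (@level_pred U n.+1)) h.
  rewrite [RHS](hE n (m n.+1)) /=; last first.
    by move=> x y /mP/(branch_level_le (leqnSn n.+1)).
  by rewrite L_map_comp; congr (L_map _ _); apply/funext => v; exact: level_pred_map.
by exists h' => n k /hE<-; exact: h'E.
Qed.

Lemma G_mapM : {morph G_map : g h / g * h}.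
Proof.
move=> g h; apply: inv_lim_inj => n.
have [k phi_k] := level_continuous_modulusS n.+1 phi_cont.
by rewrite inv_lim_coordM !(G_mapP _ phi_k) inv_lim_coordM gmulfM.
Qed.

Lemma G_map_continuous : continuous G_map.
Proof.
move=> g; apply: inv_lim_cvg => n.
have [k phi_k] := level_continuous_modulusS n.+1 phi_cont.
apply: filterS (inv_lim_coord_near g k) => h hg.
by rewrite !(G_mapP _ phi_k) hg.
Qed.

End InducedMorphism.

Lemma G_map_id (p : nat) (T : tree) (T_pruned : pruned T) (g : G_tree p T) :
  G_map T_pruned id g = g.
Proof.
apply: inv_lim_inj => n.
rewrite (G_mapP _ (@level_continuous_id T) g (is_modulus_id (leqnn n.+1))).
by rewrite level_map_id L_map_id.
Qed.

Lemma G_map_comp (p : nat) (T U V : tree) (T_pruned : pruned T) (U_pruned : pruned U)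
    (phi : branches T -> branches U) (psi : branches U -> branches V)
    (g : G_tree p T) :
  level_continuous phi -> level_continuous psi ->
  G_map U_pruned psi (G_map T_pruned phi g) = G_map T_pruned (psi \o phi) g.
Proof.
move=> phi_cont psi_cont; apply: inv_lim_inj => n.
have [m psi_m] := level_continuous_modulusS n.+1 psi_cont.
have [k phi_k] := level_continuous_modulusS m.+1 phi_cont.
have comp_cont := level_continuous_comp psi_cont phi_cont.
rewrite (G_mapP _ psi_cont _ psi_m) (G_mapP _ phi_cont _ phi_k) L_map_comp.
by rewrite level_map_comp // -(G_mapP _ comp_cont _ (is_modulus_comp psi_m phi_k)).
Qed.

Lemma level_homeomorphic_isomorphic (p : nat) (T U : tree) :
    pruned T -> pruned U -> level_homeomorphic T U ->
  topologically_isomorphic (G_tree p T) (G_tree p U).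
Proof.
move=> T_pruned U_pruned [phi [psi [phiK psiK phi_cont psi_cont]]].
pose f : {multiplicative G_tree p T -> G_tree p U} :=
  HB.pack (G_map T_pruned phi)
    (isMultiplicative.Build _ _ _ (G_mapM T_pruned phi_cont)).
exists f, (G_map U_pruned psi); split.
- have psi_phi : psi \o phi = id by exact/funext.
  by move=> g; rewrite /= G_map_comp // psi_phi G_map_id.
- have phi_psi : phi \o psi = id by exact/funext.
  by move=> h; rewrite /= G_map_comp // phi_psi G_map_id.
- exact: G_map_continuous.
- exact: G_map_continuous.
Qed.

Theorem theorem4p8 (R : realType) (p : nat) (p_prime : prime p) (p_odd : odd p)
    (T U : tree) (T_pruned : pruned T) (U_pruned : pruned U)
    (T1_infinite : infinite_set (level T 1))
    (U1_infinite : infinite_set (level U 1)) :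
  uniformly_homeomorphic (branch_space R T) (branch_space R U) <->
  topologically_isomorphic (G_tree p T) (G_tree p U).
Proof.
rewrite uniformly_homeomorphicP; split; first exact: level_homeomorphic_isomorphic.
exact: isomorphic_level_homeomorphic.
Qed.
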